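(* For every integer $d\ge 2$ there is a constant $C$ depending only on $d$ such that the following holds: if $f\in\mathbb{R}[x,y]$ is a polynomial of degree $d$ with no linear factor (no factor of degree $1$), then for every positive integer $k$ and every $k\times k$ grid in $\mathbb{R}^2$, the real plane algebraic curve $\{(x,y)\in\mathbb{R}^2 : f(x,y)=0\}$ does not contain more than $Ck^{2/3}$ points from the grid.
   Context: A $k\times k$ grid in $\mathbb{R}^2$ is the cartesian product $\{a_1+id_1 : 0\le i\le k-1\}\times\{a_2+jd_2 : 0\le j\le k-1\}$ of two real arithmetic progressions of length $k$. *)

(* Defs.v *)
From mathcomp Require Import all_boot all_order all_algebra.
From mathcomp Require Import finmap mpoly.
From mathcomp Require Import classical_sets reals.

Set Implicit Arguments.
Unset Strict Implicit.
Unset Printing Implicit Defensive.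

Import Order.TTheory GRing.Theory Num.Theory.
Local Open Scope ring_scope.

(* [msize] is one more than the total degree, and [msize 0 = 0]; in particular
   no polynomial satisfying [has_degree f d] is zero. *)
Definition has_degree (n : nat) (R : realType) (f : {mpoly R[n]}) (d : nat) :
  Prop := msize f = d.+1.

(* Factors are taken in R[x, y], not in C[x, y]. *)
Definition no_linear_factor (R : realType) (f : {mpoly R[2]}) : Prop :=
  ~ exists l g : {mpoly R[2]}, has_degree l 1 /\ f = l * g.

Definition eval2 (R : realType) (f : {mpoly R[2]}) (x y : R) : R :=
  f.@[tnth [tuple x; y]].

Definition curve (R : realType) (f : {mpoly R[2]}) : set (R * R) :=
  [set p | eval2 f p.1 p.2 = 0]%classic.

Definition progression (R : realType) (k : nat) (a d : R) : {fset R} :=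
  [fset (a + i%:R * d)%R | i in iota 0 k]%fset.

(* The common differences are not required to be nonzero; when one of them is
   zero the grid has fewer than k ^ 2 distinct points (for 1 < k). *)
Definition grid (R : realType) (k : nat) (a1 d1 a2 d2 : R) : {fset R * R} :=
  (progression k a1 d1 `*` progression k a2 d2)%fset.

Definition is_grid (R : realType) (k : nat) (G : {fset R * R}) : Prop :=
  exists a1 d1 a2 d2 : R, G = grid k a1 d1 a2 d2.

(* Main.v *)
Require Import Defs.
From mathcomp Require Import all_boot all_order all_algebra.
From mathcomp Require Import polyXY polyrcf ring lra zify.
From mathcomp Require Import boolp classical_sets reals exp.
From mathcomp Require topology normedtype derive.

(* After an affine change of coordinates the grid is {0, ..., k - 1}^2. Take an
   integer L of order k^(1/3) and cut the box into L x L cells. A cell meeting the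
   curve f = 0 either has a zero of f on its boundary or contains a critical point
   f = f_x = 0, so the curve meets O(k / L) = O(L^2) cells. A grid point on the curve
   which is not the chosen representative of its cell differs from the latter by one
   of the O(L^2) nonzero vectors v of size less than L, and for each v there are O(1)
   points p with f(p) = f(p + v) = 0. This gives O(L^2) points.

   Both finiteness claims come from eliminating x between f and a polynomial g of
   smaller degree in x (f_x, or a combination of f and its translate by v). If the
   eliminant vanishes, the zeros of f lie on those of two polynomials of smaller
   degree in x, and one argues by induction; if g = 0, then f is periodic up to a
   factor in y and its zeros lie on O(1) lines. To avoid factoring f, the induction
   replaces "no linear factor" by the hypothesis that the set of zeros considered has
   at most D points on each line, which passes to subsets. *)

Set Implicit Arguments.
Unset Strict Implicit.
Unset Printing Implicit Defensive.

Import Order.TTheory GRing.Theory Num.Theory.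
Local Open Scope ring_scope.

Lemma horner_map_eval (R : comNzRingType) (P : {poly {poly R}}) (x y : R) :
  (map_poly (horner_eval y) P).[x] = P.[x, y].
Proof. by rewrite -horner_swapXY horner2_swapXY. Qed.

(** * Critical points *)

Module CriticalPoints.
Import topology normedtype derive numFieldNormedType.Exports.
Local Open Scope classical_set_scope.

Lemma continuous_horner2 (R : realType) (P : {poly {poly R}}) :
  continuous (fun p : R * R => P.[p.1, p.2]).
Proof.
elim/poly_ind: P => [|P c IH] p.
  rewrite (_ : (fun _ => _) = fun=> 0); first exact: cvg_cst.
  by apply/funext => q; rewrite !hornerE.
rewrite (_ : (fun _ => _) = fun p : R * R => P.[p.1, p.2] * p.1 + c.[p.2]).
  apply: cvgD; first by apply: cvgM; [exact: IH | exact: cvg_fst].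
  apply: (@cvg_comp _ _ _ snd (horner c)); first exact: cvg_snd.
  exact: continuous_horner.
by apply/funext => q; rewrite !hornerE.
Qed.

(** Writing [p = q * ('X - x)] with [q.[x] != 0], the factor [q] keeps its sign near [x], so the
    values of [p] at [x - h] and [x + h] multiply to [- h ^ 2] times a positive number. *)
Lemma simple_root_sign_change (R : realType) (p : {poly R}) (a b x : R) :
  a < x < b -> root p x -> p^`().[x] != 0 ->
  exists u v, [/\ a < u, u < v, v < b & p.[u] * p.[v] < 0].
Proof.
move=> /andP[ax xb] /factor_theorem[q ->].
rewrite derivM derivXsubC mulr1 !hornerE subrr mulr0 add0r => qx0.
have [e e0 he] := @poly_cont R x q _ (ltac:(by rewrite normr_gt0) : 0 < `|q.[x]|).
pose h := Num.min (e / 2) (Num.min ((x - a) / 2) ((b - x) / 2)).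
have h0 : 0 < h by rewrite !lt_min; apply/and3P; split; lra.
have he2 : h <= e / 2 by rewrite ge_min lexx.
have ha2 : h <= (x - a) / 2 by rewrite !ge_min lexx orbT.
have hb2 : h <= (b - x) / 2 by rewrite !ge_min lexx !orbT.
have qs t : `|t - x| < e -> 0 < q.[t] * q.[x].
  move=> /he; case: (ltgtP q.[x] 0) qx0 => // q0 _.
    by rewrite (ltr0_norm q0) ltr_norml => /andP[]; nra.
  by rewrite (gtr0_norm q0) ltr_norml => /andP[]; nra.
have q1 : 0 < q.[x - h] * q.[x].
  by apply: qs; rewrite ltr_norml; apply/andP; split; lra.
have q2 : 0 < q.[x + h] * q.[x].
  by apply: qs; rewrite ltr_norml; apply/andP; split; lra.
exists (x - h), (x + h); split; try lra.
rewrite !hornerM !hornerXsubC.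
have : 0 < q.[x - h] * q.[x + h].
  have : 0 < (q.[x - h] * q.[x + h]) * q.[x] ^+ 2.
    by rewrite (_ : _ * _ = (q.[x - h] * q.[x]) * (q.[x + h] * q.[x]));
      [exact: mulr_gt0 | ring].
  by rewrite pmulr_lgt0 // lt_neqAle sqr_ge0 eq_sym sqrf_eq0 qx0.
move=> q12; rewrite [X in X < 0](_ : _ = - (h ^+ 2 * (q.[x - h] * q.[x + h]))); last by ring.
by rewrite oppr_lt0 mulr_gt0 // exprn_gt0.
Qed.

(* A highest zero in the box is critical: were it a simple root in [x], the
   sign change in [x] would persist slightly above it. *)
Lemma exists_critical_point (R : realType) (P : {poly {poly R}}) (a b c d x y : R) :
  a <= x <= b -> c <= y <= d -> P.[x, y] = 0 ->
  (forall t, a <= t <= b -> P.[t, d] != 0) ->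
  (forall t, a <= t <= b -> P.[t, c] != 0) ->
  (forall t, c <= t <= d -> P.[a, t] != 0) ->
  (forall t, c <= t <= d -> P.[b, t] != 0) ->
  exists x y, [/\ a < x < b, c < y < d, P.[x, y] = 0 & P^`().[x, y] = 0].
Proof.
move=> xab ycd P0 Pd Pc Pa Pb.
pose A := (`[a, b] `*` `[c, d]) `&` [set p : R * R | P.[p.1, p.2] = 0].
have cA : compact A.
  apply: compact_closedI; first by apply: compact_setX; exact: segment_compact.
  apply: (@preimage_closed _ _ (fun p : R * R => P.[p.1, p.2]) [set z | z = 0]);
    last exact: closed_eq.
  by move=> p _; exact: continuous_horner2.
have [] := @compact_EVT_max _ R snd A _ cA.
- by exists (x, y); split=> //; split; rewrite /= in_itv.
- by apply: continuous_subspaceT => p; exact: cvg_snd.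
move=> [x1 y1]; rewrite inE => -[[/= xab1 ycd1] P1 top].
move: xab1 ycd1; rewrite !in_itv /= => xab1 ycd1.
have lt_xab : a < x1 < b.
  move: xab1; rewrite !le_eqVlt => /andP[/orP[/eqP ax|->] /orP[/eqP xb|->]] //.
  - by have := Pa _ ycd1; rewrite ax P1 eqxx.
  - by have := Pa _ ycd1; rewrite ax P1 eqxx.
  - by have := Pb _ ycd1; rewrite -xb P1 eqxx.
have lt_ycd : c < y1 < d.
  move: ycd1; rewrite !le_eqVlt => /andP[/orP[/eqP cy|->] /orP[/eqP yd|->]] //.
  - by have := Pc _ xab1; rewrite cy P1 eqxx.
  - by have := Pc _ xab1; rewrite cy P1 eqxx.
  - by have := Pd _ xab1; rewrite -yd P1 eqxx.
exists x1, y1; split=> //; apply/eqP/negP => /negP dP.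
have [] := @simple_root_sign_change _ (map_poly (horner_eval y1) P) a b x1 lt_xab.
- by rewrite /root horner_map_eval P1.
- by rewrite deriv_map horner_map_eval.
move=> u [v [au uv vb]]; rewrite !horner_map_eval => sgn.
have sgn' : 0 < - (P.[u, y1] * P.[v, y1]) by rewrite oppr_gt0.
have [eu eu0 hu] := poly_cont y1 (P.[u%:P] * P.[v%:P]) sgn'.
pose h := Num.min (eu / 2) ((d - y1) / 2).
have h0 : 0 < h by rewrite !lt_min; apply/andP; split; lra.
have he2 : h <= eu / 2 by rewrite ge_min lexx.
have hb2 : h <= (d - y1) / 2 by rewrite ge_min lexx orbT.
have /hu : `|y1 + h - y1| < eu by rewrite ltr_norml; apply/andP; split; lra.
rewrite !hornerM ltr_norml => /andP[_ neg].
have [] := @poly_ivtoo R (map_poly (horner_eval (y1 + h)) P) u v (ltW uv).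
  by rewrite !horner_map_eval; lra.
move=> z; rewrite in_itv /= /root horner_map_eval => /andP[uz zv] /eqP Pz.
have : y1 + h <= y1; last by lra.
apply: (top (z, y1 + h)); rewrite inE; split=> //; split; rewrite /= in_itv /=; apply/andP; split; lra.
Qed.

End CriticalPoints.

(** * Elimination *)

Section Elimination.
Variable R : idomainType.
Implicit Types (P Q U W : {poly {poly R}}) (c r : {poly R}).

Lemma sizeYM_leq P Q a b :
  (sizeY P <= a -> sizeY Q <= b -> sizeY (P * Q) <= a + b)%N.
Proof.
rewrite !sizeYE rmorphM => leP leQ; apply: leq_trans (size_polyMleq _ _) _.
exact: leq_trans (leq_pred _) (leq_add leP leQ).
Qed.

Lemma sizeYD_leq P Q a :
  (sizeY P <= a -> sizeY Q <= a -> sizeY (P + Q) <= a)%N.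
Proof.
rewrite !sizeYE rmorphD => leP leQ; apply: leq_trans (size_polyD _ _) _.
by rewrite geq_max leP.
Qed.

Lemma sizeYN P : sizeY (- P) = sizeY P.
Proof. by rewrite !sizeYE rmorphN size_polyN. Qed.

Lemma sizeYC c : sizeY c%:P = size c.
Proof. by rewrite sizeYE swapXY_polyC size_map_polyC. Qed.

Lemma sizeY_Xn k : (sizeY ('X^k : {poly {poly R}}) <= 1)%N.
Proof. by rewrite sizeYE rmorphXn /= swapXY_X -polyC_exp size_polyC leq_b1. Qed.

(* Only the leading term is cancelled; this is not the full pseudo-remainder. *)
Definition pseudo_rem P Q : {poly {poly R}} :=
  (lead_coef Q)%:P * P - (lead_coef P)%:P * 'X^(size P - size Q) * Q.

Lemma size_pseudo_rem P Q :
  P != 0 -> Q != 0 -> (size Q <= size P)%N -> (size (pseudo_rem P Q) < size P)%N.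
Proof.
move=> P0 Q0 leQP; have sP : (0 < size P)%N by rewrite size_poly_gt0.
have sQ : (0 < size Q)%N by rewrite size_poly_gt0.
rewrite -(ltn_predK sP) ltnS; apply/leq_sizeP => j ltj.
rewrite coefB coefCM -mulrA coefCM coefXnM.
case: ifP => [|/negbT]; first by lia.
rewrite -leqNgt => le_j; have [->|ne] := eqVneq j (size P).-1.
  by rewrite -lead_coefE (_ : _ - _ = (size Q).-1)%N; [rewrite -lead_coefE; ring | lia].
have ltPj : (size P <= j)%N by lia.
rewrite (nth_default _ ltPj) (nth_default _ (_ : size Q <= _)%N); last by lia.
by rewrite !mulr0 subr0.
Qed.

Lemma sizeY_pseudo_rem P Q e : (sizeY P <= e)%N -> (sizeY Q <= e)%N ->
  (sizeY (pseudo_rem P Q) <= e + 1 + e)%N.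
Proof.
move=> eP eQ; apply: sizeYD_leq.
  apply: leq_trans (sizeYM_leq (_ : _ <= e)%N eP) _; last by lia.
  by rewrite sizeYC (leq_trans (max_size_lead_coefXY Q)).
rewrite sizeYN; apply: sizeYM_leq eQ; apply: sizeYM_leq (sizeY_Xn _).
by rewrite sizeYC (leq_trans (max_size_lead_coefXY P)).
Qed.

(** Euclid's algorithm over [{poly R}] with cofactors. Each step lowers [size P + size Q] and
    replaces the bound [e] by [e + 1 + e], so [N] depends on [n] and [e] only. The bound
    [size W < size P] is what later lets an induction on the degree in [x] apply to [W]. *)
Lemma bounded_elimination_aux n e : exists N, forall P Q, P != 0 -> Q != 0 ->
  (2 < size P + size Q <= n)%N -> (sizeY P <= e)%N -> (sizeY Q <= e)%N ->
  exists U W r, [/\ U * P + W * Q = r%:P, (U != 0) || (W != 0),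
    (size W < size P)%N, (size U < size Q)%N & (sizeY U <= N)%N && (sizeY W <= N)%N].
Proof.
elim: n e => [|n IHn] e; first by exists 0%N => P Q _ _; lia.
have [N1 hN] := IHn (e + 1 + e)%N; exists (N1 + e + 2)%N => P Q.
wlog leQP : P Q / (size Q <= size P)%N.
  move=> sym; have [|ltPQ] := leqP (size Q) (size P); first exact: sym.
  move=> P0 Q0 szPQ eP eQ.
  have [|||U [W [r [eqr UW0 szW szU /andP[eU eW]]]]] := sym _ _ (ltnW ltPQ) Q0 P0 => //.
    by rewrite addnC.
  exists W, U, r; rewrite addrC orbC; split=> //; exact/andP.
move=> P0 Q0 szPQ eP eQ.
have sP : (0 < size P)%N by rewrite size_poly_gt0.
have sQ : (0 < size Q)%N by rewrite size_poly_gt0.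
(* A [Q] that is constant in [x] is itself the eliminant. *)
have [szQ1|szQ1] := eqVneq (size Q) 1%N.
  have [q q0 Qq] : exists2 q, q != 0 & Q = q%:P by apply/size_poly1P/eqP.
  exists 0, 1, q; rewrite mul0r add0r mul1r oner_eq0 orbT size_poly1 size_poly0.
  by split=> //; [lia | rewrite !sizeYE rmorph0 rmorph1 size_poly0 size_poly1; lia].
have szQ2 : (1 < size Q)%N by rewrite ltn_neqAle eq_sym szQ1.
have ltk : ((size P - size Q).+1 < size P)%N by lia.
set a := lead_coef P; set b := lead_coef Q; set k := (size P - size Q)%N.
have b0 : b != 0 by rewrite lead_coef_eq0.
have := size_pseudo_rem P0 Q0 leQP; have := sizeY_pseudo_rem eP eQ.
set P1 := pseudo_rem P Q => eP1 szP1.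
have P1E : P1 = b%:P * P - a%:P * 'X^k * Q by [].
have eXk : (sizeY (a%:P * 'X^k) <= e + 1)%N.
  apply: sizeYM_leq (sizeY_Xn _).
  by rewrite sizeYC (leq_trans (max_size_lead_coefXY P)).
have szXk : (size (a%:P * 'X^k)%R <= k.+1)%N.
  rewrite mul_polyC; apply: leq_trans (size_scale_leq _ _) _.
  by rewrite size_polyXn.
have eb : (size b <= e)%N by apply: leq_trans eQ; apply: max_size_lead_coefXY.
(* If the pseudo-remainder vanishes, its defining formula is already a relation with [r = 0]; the
   strict size bounds come from [1 < size Q]. *)
have [P10|P10] := eqVneq P1 0.
  exists b%:P, (- (a%:P * 'X^k)), 0; split.
  - by rewrite polyC0 -P10 P1E; ring.
  - by rewrite polyC_eq0 b0.
  - by rewrite size_polyN; apply: leq_ltn_trans szXk _.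
  - by rewrite size_polyC b0.
  - rewrite sizeYN sizeYC; apply/andP; split.
      by apply: leq_trans eb _; lia.
    by apply: leq_trans eXk _; lia.
(* A relation for [P1] and [Q] becomes one for [P] and [Q] by expanding [P1]; as [b] is nonzero, the
   cofactors do not both vanish. *)
have [|||U [W [r [eqr UW0 szW szU /andP[eU eW]]]]] := hN P1 Q P10 Q0 => //.
- have : (0 < size P1)%N by rewrite size_poly_gt0.
  by lia.
- by apply: leq_trans eQ _; lia.
exists (U * b%:P), (W - U * (a%:P * 'X^k)), r; split.
- by rewrite -eqr P1E; ring.
- rewrite mulf_eq0 negb_or polyC_eq0 b0 andbT.
  by case: (eqVneq U 0) UW0 => [-> | //] /=; rewrite mul0r subr0.
- apply: leq_ltn_trans (size_polyD _ _) _; rewrite size_polyN gtn_max.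
  rewrite (ltn_trans szW) //=; apply: leq_ltn_trans (size_polyMleq _ _) _.
  apply: (@leq_ltn_trans (size U + k)%N); last by rewrite addnC -ltn_subRL subKn.
  by rewrite -subn1 leq_subLR add1n -addnS leq_add2l.
- apply: leq_ltn_trans (size_polyMleq _ _) _.
  by rewrite size_polyC b0 addn1.
- apply/andP; split.
    by apply: leq_trans (sizeYM_leq eU (_ : _ <= e)%N) _; [rewrite sizeYC | lia].
  apply: sizeYD_leq; first by lia.
  by rewrite sizeYN; apply: leq_trans (sizeYM_leq eU eXk) _; lia.
Qed.

(* Either [r = 0], and then [W * Q] vanishes on the zero set of [P], or the
   common zeros of [P] and [Q] lie on the lines [y = t] with [r.[t] = 0]. *)
Lemma bounded_elimination m e : exists N, forall P Q, Q != 0 ->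
  (1 < size P <= m)%N -> (size Q <= m)%N -> (sizeY P <= e)%N -> (sizeY Q <= e)%N ->
  exists U W r, [/\ U * P + W * Q = r%:P, W != 0,
    (size W < size P)%N, (sizeY W <= N)%N & (size r <= N)%N].
Proof.
have [N hN] := bounded_elimination_aux (m + m) e.
exists (N + e)%N => P Q Q0 /andP[szP szPm] szQ eP eQ.
have P0 : P != 0 by rewrite -size_poly_gt0; lia.
have := Q0; rewrite -size_poly_gt0 => sQ.
have [|||U [W [r [eqr UW0 szW szU /andP[eU eW]]]]] := hN P Q P0 Q0 => //; first by lia.
exists U, W, r; split=> //; last 2 first.
- by lia.
- by rewrite -sizeYC -eqr; apply: sizeYD_leq; apply: sizeYM_leq.
(* If [W = 0], then [U * P] is constant in [x] while [P] is not, so [U = 0] as well. *)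
apply: contraL UW0 => /eqP W0; rewrite W0 eqxx orbF negbK.
apply: contraTT szP => U0; rewrite -leqNgt.
apply: leq_trans (size_polyC_leq1 r); rewrite -eqr W0 mul0r addr0 size_mul //.
by move: U0; rewrite -size_poly_gt0; case: (size U) => [//|u _]; rewrite addSn leq_addl.
Qed.

End Elimination.

(** * Counting lemmas *)

Lemma size_le_fibers (A B : eqType) (h : A -> B) (K : seq B) (s : seq A) n :
  {in s, forall a, h a \in K} ->
  {in K, forall b, (count (fun a => h a == b) s <= n)%N} ->
  (size s <= size K * n)%N.
Proof.
elim: K s => [|b K IH] s hK hn.
  by case: s hK {hn} => [//|a s] /(_ a); rewrite mem_head => /(_ isT).
rewrite -(count_predC (fun a => h a == b) s) mulSn leq_add ?hn ?mem_head //.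
rewrite -size_filter; apply: IH => [a|b' b'K].
  rewrite mem_filter /= => /andP[hab as_].
  by have := hK a as_; rewrite inE (negbTE hab).
have b'bK : b' \in b :: K by rewrite inE b'K orbT.
by apply: leq_trans (hn b' b'bK); rewrite count_filter; apply: sub_count => a /andP[].
Qed.

Lemma size_le_filters (A : eqType) (ps : seq (pred A)) (s : seq A) :
  {in s, forall a, has (fun p : pred A => p a) ps} ->
  (size s <= sumn [seq size (filter p s) | p <- ps])%N.
Proof.
elim: ps s => [|p ps IH] s h /=.
  by case: s h => // a s /(_ a); rewrite mem_head => /(_ isT).
rewrite -(count_predC p s) -size_filter leq_add2l -size_filter.
apply: leq_trans (IH (filter (predC p) s) _) _.
  by move=> a; rewrite mem_filter => /andP[/negbTE pa /h] /=; rewrite pa.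
elim: (ps) => //= q qs IHq; rewrite leq_add // !size_filter count_filter.
by apply: sub_count => a /andP[].
Qed.

(** Roots chosen for distinct elements are distinct, since [V] recovers the element from the root. A
    relation is used so that [V] can be membership in an interval or a cell. *)
Lemma size_lt_roots (R : idomainType) (T : eqType) (p : {poly R}) (s : seq T)
    (V : T -> R -> Prop) :
  p != 0 -> uniq s ->
  {in s, forall t, exists2 y, root p y & V t y} ->
  {in s &, forall t t', forall y, V t y -> V t' y -> t = t'} ->
  (size s < size p)%N.
Proof.
move=> p0 us hV inj.
suff [ys [<- uys rys _]] : exists ys : seq R, [/\ size ys = size s, uniq ys,
    all (root p) ys & {in ys, forall y, exists2 t, t \in s & V t y}].
  exact: max_poly_roots.
elim: s us hV inj => [|t s IH] /= us hV inj; first by exists [::].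
case/andP: us => ts us.
have [||ys [sys uys rys Vys]] := IH us.
- by move=> t' t's; apply: hV; rewrite inE t's orbT.
- by move=> t1 t2 t1s t2s; apply: inj; rewrite inE ?t1s ?t2s orbT.
have [y ry Vty] := hV t (mem_head _ _).
exists (y :: ys); split=> /=; rewrite ?sys ?uys ?rys ?ry ?andbT //.
  apply/negP => /Vys[t' t's Vt'y]; move/negP: ts; apply.
  by rewrite (inj t t' _ _ y Vty Vt'y) ?mem_head // inE t's orbT.
move=> z; rewrite inE => /predU1P[-> | /Vys[t' t's Vt'z]].
  by exists t; rewrite ?mem_head.
by exists t' => //; rewrite inE t's orbT.
Qed.

(** The [size p] equally spaced points [v k] lie in the interval and cannot all be roots. *)
Lemma exists_nonroot_itv01 (R : numFieldType) (p : {poly R}) :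
  p != 0 -> exists2 t, 0 < t < 1 & p.[t] != 0.
Proof.
move=> p0; pose v (k : nat) : R := k.+1%:R / (size p).+2%:R.
have [/hasP[k]|] := boolP (has (fun k => p.[v k] != 0) (iota 0 (size p))).
  rewrite mem_iota add0n /= => lek pk; exists (v k) => //.
  by rewrite /v divr_gt0 ?ltr0n //= ltr_pdivrMr ?ltr0n // mul1r ltr_nat; lia.
move=> /hasPn noroot; suff : (size (map v (iota 0 (size p))) < size p)%N.
  by rewrite size_map size_iota ltnn.
apply: max_poly_roots => //.
  apply/allP => _ /mapP[k /noroot hk ->].
  by move: hk; rewrite negbK.
rewrite map_inj_uniq ?iota_uniq // => k l.
have z : (size p).+2%:R != 0 :> R by rewrite pnatr_eq0.
by move=> /(mulIf (invr_neq0 z)) /eqP; rewrite eqr_nat eqSS => /eqP.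
Qed.

Lemma eq0_of_nat_roots (R : numDomainType) (p : {poly R}) (n0 : nat) :
  (forall n, (n0 <= n)%N -> p.[n%:R] = 0) -> p = 0.
Proof.
move=> h; apply: (@roots_geq_poly_eq0 _ p (map (fun n : nat => n%:R) (iota n0 (size p)))).
- by apply/allP => _ /mapP[n + ->]; rewrite mem_iota => /andP[/h pn _]; apply/eqP.
- by rewrite map_inj_uniq ?iota_uniq // => k l /eqP; rewrite eqr_nat => /eqP.
- by rewrite size_map size_iota.
Qed.

(* [p / q] is a periodic rational function, hence constant. *)
Lemma eq0_of_periodic_ratio (R : realType) (p q : {poly R}) :
  (forall t, p.[t] * q.[t + 1] = p.[t + 1] * q.[t]) ->
  p.[0] = 0 -> q.[0] != 0 -> p = 0.
Proof.
move=> per p0 q00.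
have q0 : q != 0 by apply: contraNneq q00 => ->; rewrite horner0.
(* Beyond its Cauchy bound [q] has no root, so the ratio is defined at every integer from [n0] on,
   and it is constant there. *)
have [n0 hn0] : exists n0, forall n, (n0 <= n)%N -> q.[n%:R] != 0.
  exists (Num.truncn (cauchy_bound q)).+1 => n len.
  apply/negP => /eqP /(cauchy_boundP q0).
  rewrite ger0_norm // => lt; have := truncnS_gt (cauchy_bound q).
  by have : (Num.truncn (cauchy_bound q)).+1%:R <= n%:R :> R; [rewrite ler_nat | lra].
pose c := p.[n0%:R] / q.[n0%:R].
have pE n : (n0 <= n)%N -> p.[n%:R] = c * q.[n%:R].
  elim: n => [|n IH] len.
    have n00 : n0 = 0%N by lia.
    by rewrite /c n00 divfK //; exact: hn0.
  have [<-|ne] := eqVneq n0 n.+1; first by rewrite /c divfK // hn0.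
  have len' : (n0 <= n)%N by lia.
  apply: (mulIf (hn0 n len')); rewrite mulrAC -(IH len') -natr1 per.
  by rewrite mulrC.
have : p - c *: q = 0.
  by apply: (@eq0_of_nat_roots _ _ n0) => n /pE; rewrite !hornerE => ->; rewrite subrr.
(* Evaluating [p = c *: q] at [0] forces [c = 0]. *)
move=> /subr0_eq pcq; move: p0; rewrite pcq !hornerE => /eqP.
by rewrite mulf_eq0 (negbTE q00) orbF => /eqP ->; rewrite scale0r.
Qed.

(** * Zeros of bivariate polynomials on integer points *)

Section FewZeros.
Variable R : realType.
Implicit Types (P Q W : {poly {poly R}}) (q : {poly R}) (D C : nat) (S : seq (nat * nat)).

Definition line_bounded D S := forall a b c : R, (a != 0) || (b != 0) ->
  (count (fun p : nat * nat => a * p.1%:R + b * p.2%:R == c)%R S <= D)%N.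

(* The box has side [L ^ 3], so [L ^ 2] plays the role of [k `^ (2 / 3)]. *)
Definition few_zeros P D C := forall L S, (0 < L)%N -> uniq S ->
  {in S, forall p, (p.1 < L ^ 3)%N && (p.2 < L ^ 3)%N} -> line_bounded D S ->
  {in S, forall p, P.[p.1%:R, p.2%:R] = 0} -> (size S <= C * L ^ 2)%N.

Lemma line_bounded_filter D S (a : pred (nat * nat)) :
  line_bounded D S -> line_bounded D (filter a S).
Proof.
move=> hS u v c uv; apply: leq_trans (hS u v c uv).
by rewrite count_filter; apply: sub_count => p /andP[].
Qed.

Lemma few_zeros_mono P D C C' : (C <= C')%N -> few_zeros P D C -> few_zeros P D C'.
Proof.
move=> le h L S L0 uS bS lS zS.
exact: leq_trans (h L S L0 uS bS lS zS) (leq_mul le (leqnn _)).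
Qed.

Lemma few_zeros_union P Q W D C C' :
  (forall x y, P.[x, y] = 0 -> Q.[x, y] * W.[x, y] = 0) ->
  few_zeros Q D C -> few_zeros W D C' -> few_zeros P D (C + C').
Proof.
move=> hP hQ hW L S L0 uS bS lS zS.
rewrite mulnDl; apply: leq_trans (@size_le_filters _ [:: (fun p => Q.[p.1%:R, p.2%:R] == 0);
  (fun p => W.[p.1%:R, p.2%:R] == 0)] S _) _.
  by move=> p pS /=; rewrite orbF -mulf_eq0; apply/eqP; exact: hP (zS p pS).
rewrite /= addn0; apply: leq_add; [apply: hQ | apply: hW] => //; rewrite ?filter_uniq //;
  try exact: line_bounded_filter;
  by move=> p; rewrite mem_filter => /andP[hp pS]; [exact: bS || exact/eqP..].
Qed.

(** The points lie on fewer than [size q] horizontal lines, each carrying at most [D] of them. *)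
Lemma size_le_ordinates q D S : q != 0 -> line_bounded D S ->
  {in S, forall p, q.[p.2%:R] = 0} -> (size S <= size q * D)%N.
Proof.
move=> q0 lS zS; apply: leq_trans (@size_le_fibers _ _ snd (undup (map snd S)) S D _ _) _.
- by move=> p pS; rewrite mem_undup map_f.
- move=> b _; apply: leq_trans (lS 0 1 b%:R _); last by rewrite oner_eq0 orbT.
  by apply: sub_count => p /= /eqP <-; rewrite mul0r mul1r add0r.
rewrite leq_mul2r (ltnW (@size_lt_roots _ _ q _ (fun t y => y = t%:R) q0 _ _ _)) ?orbT //.
- exact: undup_uniq.
- move=> t; rewrite mem_undup => /mapP[p pS ->]; exists p.2%:R => //.
  by apply/eqP; exact: zS.
- by move=> t t' _ _ y -> /eqP; rewrite eqr_nat => /eqP.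
Qed.

Lemma slice_neq0 P y : (lead_coef P).[y] != 0 -> map_poly (horner_eval y) P != 0.
Proof.
apply: contraNneq => sl0; rewrite lead_coefE -[_.[y]]/(horner_eval y _) -coef_map.
by rewrite /= sl0 coef0.
Qed.

(** The translate of [P] by [(a, b)]: the coefficients are translated in [y], then the outer
    variable in [x]. *)
Definition shift P (a b : R) : {poly {poly R}} :=
  map_poly (comp_poly ('X + b%:P)) P \Po ('X + (a%:P)%:P).

Lemma horner_shift P a b x y : (shift P a b).[x, y] = P.[x + a, y + b].
Proof.
rewrite /shift horner_comp hornerD hornerX hornerC -polyCD.
rewrite -{1}(comp_polyC (x + a) ('X + b%:P)); rewrite (horner_map (comp_poly ('X + b%:P))) /=.
by rewrite horner_comp !hornerE.
Qed.

Lemma comp_polyXaddC_inj (b : R) : injective (comp_poly ('X + b%:P)).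
Proof.
apply: (@can_inj _ _ _ (fun q => q \Po ('X - b%:P))) => q.
by rewrite /= -comp_polyA comp_polyD comp_polyX comp_polyC subrK comp_polyXr.
Qed.

Lemma size_shift P a b : size (shift P a b) = size P.
Proof.
rewrite /shift size_comp_poly2 ?size_XaddC //.
by rewrite size_map_inj_poly ?comp_poly0 //; exact: comp_polyXaddC_inj.
Qed.

Lemma lead_coef_shift P a b :
  lead_coef (shift P a b) = lead_coef P \Po ('X + b%:P).
Proof.
rewrite /shift lead_coef_comp ?size_XaddC // lead_coefXaddC expr1n mulr1.
by rewrite lead_coef_map_inj ?comp_poly0 //; exact: comp_polyXaddC_inj.
Qed.

Lemma sizeY_shift P a b : (sizeY (shift P a b) <= sizeY P + 1)%N.
Proof.
rewrite /shift comp_polyE.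
apply: (big_ind (fun Q : {poly {poly R}} => (sizeY Q <= sizeY P + 1)%N)).
- by rewrite sizeYE rmorph0 size_poly0.
- by move=> Q W; apply: sizeYD_leq.
move=> i _; rewrite -mul_polyC; apply: sizeYM_leq.
  rewrite sizeYC coef_map_id0 ?comp_poly0 //= size_comp_poly2 ?size_XaddC //.
  exact: max_size_coefXY.
rewrite sizeYE rmorphXn rmorphD /= swapXY_X swapXY_polyC map_polyC /= -polyCD -polyC_exp.
by rewrite size_polyC leq_b1.
Qed.

(* Along the line, [P] and its leading coefficient are univariate polynomials
   whose quotient is invariant under [t |-> t + 1]. *)
Lemma zero_along_line P (x y a b : R) :
  pseudo_rem P (shift P a b) = 0 -> P.[x, y] = 0 -> (lead_coef P).[y] != 0 ->
  forall t, P.[x + a * t, y + b * t] = 0.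
Proof.
move=> rem0 P0 lc0.
pose Y : {poly R} := y%:P + b *: 'X; pose X : {poly R} := x%:P + a *: 'X.
pose F := (map_poly (comp_poly Y) P).[X].
have FE t : F.[t] = P.[x + a * t, y + b * t].
  rewrite /F -[LHS]/(horner_eval t _) -horner_map /= -map_poly_comp.
  have -> : map_poly (horner_eval t \o comp_poly Y) P = map_poly (horner_eval (y + b * t)) P.
    by apply: eq_map_poly => q /=; rewrite /horner_eval horner_comp !hornerE.
  by rewrite /horner_eval !hornerE horner_map_eval.
pose lam := lead_coef P \Po Y.
have lamE t : lam.[t] = (lead_coef P).[y + b * t] by rewrite horner_comp !hornerE.
suff F0 : F = 0 by move=> t; rewrite -FE F0 horner0.
apply: (@eq0_of_periodic_ratio _ F lam); last 2 first.
- by rewrite FE !mulr0 !addr0.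
- by rewrite lamE mulr0 addr0.
move=> t; rewrite !FE !lamE.
have := congr1 (fun Q => Q.[x + a * t, y + b * t]) rem0.
rewrite /pseudo_rem size_shift subnn expr0 mulr1 lead_coef_shift.
rewrite hornerD hornerN !hornerM !hornerC hornerD hornerN !hornerM horner_shift.
rewrite horner_comp !hornerE => /subr0_eq.
by rewrite !mulrDr !mulr1 !addrA [RHS]mulrC => <-; rewrite mulrC.
Qed.

(** Points where the leading coefficient vanishes lie on few horizontal lines. Through any other
    point of [S] the whole line in direction [(a, b)] consists of zeros, and such lines cut a
    horizontal line on which [P] is not identically zero in distinct roots, so they are few too. *)
Lemma few_zeros_of_periodic P D (a b : R) : P != 0 -> (a != 0) || (b != 0) ->
  pseudo_rem P (shift P a b) = 0 -> few_zeros P D ((sizeY P + size P) * D).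
Proof.
move=> P0 ab0 rem0 L S L0 uS bS lS zS.
have lc0 : lead_coef P != 0 by rewrite lead_coef_eq0.
apply: (@leq_trans ((sizeY P + size P) * D)%N); last first.
  by rewrite leq_pmulr // expn_gt0 L0.
pose u (p : nat * nat) := (lead_coef P).[p.2%:R] == 0.
rewrite mulnDl; apply: leq_trans (@size_le_filters _ [:: u; (predC u : pred _)] S _) _.
  by move=> p _ /=; case: (u p).
rewrite /= addn0; apply: leq_add.
  apply: leq_trans (size_le_ordinates lc0 (line_bounded_filter _ lS) _) _.
    by move=> p; rewrite mem_filter => /andP[/eqP].
  by rewrite leq_mul2r max_size_lead_coefXY orbT.
have lS' := line_bounded_filter (predC u) lS.
have onS p t : p \in filter (predC u) S -> P.[p.1%:R + a * t, p.2%:R + b * t] = 0.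
  by rewrite mem_filter => /andP[up pS]; apply: zero_along_line => //; exact: zS.
case ES : (filter (predC u) S) => [//|p0 S']; rewrite -ES.
have p0S : p0 \in filter (predC u) S by rewrite ES mem_head.
have up0 : (lead_coef P).[p0.2%:R] != 0 by move: p0S; rewrite mem_filter => /andP[].
pose sl := map_poly (horner_eval p0.2%:R) P.
have sl0 : sl != 0 by exact: slice_neq0.
(* If [b = 0], the line of zeros through [p0] is horizontal and the slice [sl] vanishes
   identically. *)
have b0 : b != 0.
  apply: contraNneq sl0 => b0; move: ab0; rewrite b0 eqxx orbF => a0.
  apply/eqP/(@eq0_of_nat_roots _ _ 0) => n _; rewrite horner_map_eval.
  have := onS p0 ((n%:R - p0.1%:R) / a) p0S.
  by rewrite b0 mul0r addr0 mulrC divfK // addrC subrK.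
(* [h] labels the lines in direction [(a, b)]. *)
pose h (p : nat * nat) : R := b * p.1%:R + (- a) * p.2%:R.
apply: leq_trans (@size_le_fibers _ _ h (undup (map h (filter (predC u) S))) _ D _ _) _.
- by move=> p pS; rewrite mem_undup map_f.
- by move=> c _; apply: lS'; rewrite b0.
rewrite leq_mul2r; apply/orP; right.
apply: leq_trans (ltnW (@size_lt_roots _ _ sl _ (fun k x => k = b * x - a * p0.2%:R) sl0 _ _ _)) _.
- exact: undup_uniq.
- move=> k; rewrite mem_undup => /mapP[p pS ->].
  exists (p.1%:R + a * ((p0.2%:R - p.2%:R) / b)).
    rewrite /root horner_map_eval; apply/eqP.
    have := onS p ((p0.2%:R - p.2%:R) / b) pS.
    by rewrite [b * _]mulrC divfK // [_ + (_ - _)]addrC subrK.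
  by rewrite /h; field.
- by move=> k k' _ _ x -> ->.
exact: size_poly.
Qed.

End FewZeros.

(** * Cells and translation vectors *)

Section Cells.
Variable R : realType.
Implicit Types (P U W : {poly {poly R}}) (q r : {poly R}).

(** The product of the finitely many nonzero polynomials [G i] is nonzero, so it has a non-root in
    the open unit interval. *)
Lemma exists_generic_offset (I : eqType) (s : seq I) (F : I -> {poly R}) (c : I -> R) :
  {in s, forall i, F i != 0} ->
  exists2 t, 0 < t < 1 & {in s, forall i, (F i).[c i - t] != 0}.
Proof.
move=> F0; pose G i := F i \Po ((c i)%:P - 'X).
have [|t t01] := @exists_nonroot_itv01 R (\prod_(i <- s) G i).
  rewrite prodf_seq_neq0; apply/allP => i is_ /=; rewrite comp_poly2_eq0 ?F0 //.
  by rewrite -size_polyN opprB size_XsubC.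
rewrite horner_prod prodf_seq_neq0 => /allP Gt; exists t => // i /Gt /=.
by rewrite horner_comp !hornerE.
Qed.

(** Each line of the cell grid carries fewer than [n] roots, and a root lies in at most one of the
    disjoint open edges. [h c] names the line and [g c] the position along it, so that vertical and
    horizontal edges are treated alike. *)
Lemma size_le_edge_zeros (T : seq (nat * nat)) (h g : nat * nat -> nat) (M n : nat)
    (p : nat -> {poly R}) (z : nat -> R) :
  uniq T -> (forall c c', h c = h c' -> g c = g c' -> c = c') ->
  {homo z : i j / (i <= j)%N >-> i <= j} ->
  (forall i, (i < M)%N -> p i != 0 /\ (size (p i) <= n)%N) ->
  {in T, forall c, (h c < M)%N /\
     exists2 t, root (p (h c)) t & z (g c) < t < z (g c).+1} ->
  (size T <= M * n)%N.
Proof.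
move=> uT inj hz hp hT.
rewrite -[M](size_iota 0); apply: (@size_le_fibers _ _ h).
  by move=> c /hT[]; rewrite mem_iota.
move=> i; rewrite mem_iota add0n /= => /hp[pi0 szp].
rewrite -size_filter; apply: leq_trans (ltnW _) szp.
apply: (@size_lt_roots _ _ (p i) _ (fun c t => z (g c) < t < z (g c).+1)) => //.
- by rewrite filter_uniq.
- by move=> c; rewrite mem_filter => /andP[/eqP hc /hT[_ ]]; rewrite hc.
move=> c c'; rewrite !mem_filter => /andP[/eqP hc _] /andP[/eqP hc' _] t.
move=> /andP[t1 t2] /andP[t3 t4]; apply: inj; first by rewrite hc hc'.
case: (ltngtP (g c) (g c')) => // /hz le.
  by have := lt_trans (lt_le_trans t2 le) t3; rewrite ltxx.
by have := lt_trans (lt_le_trans t4 le) t1; rewrite ltxx.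
Qed.

Lemma size_slice_leq P y : (size (map_poly (horner_eval y) P) <= size P)%N.
Proof. exact: size_poly. Qed.

(* The cell grid is shifted so that no corner of a cell is a zero of [P]. A cell
   containing a zero then has a zero on an edge, or a critical point inside, whose
   ordinate is a root of [r]. *)
Lemma size_cells_leq P U W r (L M : nat) (T : seq (nat * nat)) :
  P != 0 -> U * P + W * P^`() = r%:P -> r != 0 -> (0 < L)%N -> uniq T ->
  {in T, forall c, (c.1 < M)%N && (c.2 < M)%N} ->
  {in T, forall c, exists2 p : nat * nat, (p.1 %/ L, p.2 %/ L)%N = c
                                        & P.[p.1%:R, p.2%:R] = 0} ->
  (size T <= M * (2 * (sizeY P + size P)) + size r * size P)%N.
Proof.
move=> P0 eqr r0 L0 uT bT zT.
have lc0 : lead_coef P != 0 by rewrite lead_coef_eq0.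
(* The vertical offset comes first and avoids the roots of the leading coefficient, so that [P] is
   not identically zero on any line [y = y j]; the horizontal offset [ta] then avoids the roots of
   [P] on these lines. *)
have [sg sg01 hsg] := @exists_generic_offset _ (iota 0 M.+1) (fun=> lead_coef P)
  (fun j => (j * L)%:R) (fun _ _ => lc0).
pose y (j : nat) : R := (j * L)%:R - sg.
have [|ta ta01 hta] := @exists_generic_offset _
  [seq (i, j) | i <- iota 0 M.+1, j <- iota 0 M.+1]
  (fun ij => map_poly (horner_eval (y ij.2)) P) (fun ij => (ij.1 * L)%:R).
  by move=> _ /allpairsP[[i j] [/= _ jM ->]]; apply: slice_neq0; exact: hsg.
pose x (i : nat) : R := (i * L)%:R - ta.
have corner i j : (i <= M)%N -> (j <= M)%N -> P.[x i, y j] != 0.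
  move=> iM jM; rewrite -horner_map_eval; apply: (hta (i, j)).
  by rewrite allpairs_f // mem_iota.
have homox : {homo x : i j / (i <= j)%N >-> i <= j}.
  by move=> i j ij; rewrite /x lerD2r ler_nat leq_mul2r ij orbT.
have homoy : {homo y : i j / (i <= j)%N >-> i <= j}.
  by move=> i j ij; rewrite /y lerD2r ler_nat leq_mul2r ij orbT.
(* As the offset lies strictly between [0] and [1], an integer stays strictly inside the shifted
   interval with its own index. *)
have inx n : x (n %/ L)%N < n%:R < x (n %/ L).+1.
  have h1 : ((n %/ L) * L <= n)%N by rewrite leq_trunc_div.
  have h2 : (n.+1 <= (n %/ L).+1 * L)%N by rewrite ltn_ceil.
  move: h1 h2; rewrite -(ler_nat R) -(ler_nat R n.+1) -natr1 /x.
  by move=> h1 h2; apply/andP; split; lra.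
have iny n : y (n %/ L)%N < n%:R < y (n %/ L).+1.
  have h1 : ((n %/ L) * L <= n)%N by rewrite leq_trunc_div.
  have h2 : (n.+1 <= (n %/ L).+1 * L)%N by rewrite ltn_ceil.
  move: h1 h2; rewrite -(ler_nat R) -(ler_nat R n.+1) -natr1 /y.
  by move=> h1 h2; apply/andP; split; lra.
pose vert i (c : nat * nat) := exists2 t, root P.[(x i)%:P] t & y c.2 < t < y c.2.+1.
pose horz j (c : nat * nat) :=
  exists2 t, root (map_poly (horner_eval (y j)) P) t & x c.1 < t < x c.1.+1.
(* The condition at the left edge shows that [P] is not identically zero at height [t], so fewer
   than [size P] critical points share that height. *)
pose crit (c : nat * nat) t := [/\ r.[t] = 0, y c.2 < t < y c.2.+1, P.[x c.1, t] != 0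
  & exists2 s, P.[s, t] = 0 & x c.1 < s < x c.1.+1].
have vert_poly i : (i <= M)%N -> P.[(x i)%:P] != 0 /\ (size P.[(x i)%:P] <= sizeY P)%N.
  move=> iM; split; last exact: max_size_evalC.
  by apply: contraNneq (corner i 0%N iM (leq0n _)) => ->; rewrite horner0.
have horz_poly j : (j <= M)%N -> map_poly (horner_eval (y j)) P != 0 /\
    (size (map_poly (horner_eval (y j)) P) <= size P)%N.
  move=> jM; split; last exact: size_slice_leq.
  by apply: contraNneq (corner 0%N j (leq0n _) jM); rewrite -horner_map_eval => ->; rewrite horner0.
(* The five classes of cells: a zero on the left, right, lower or upper edge, or a critical point
   inside. *)
apply: leq_trans (@size_le_filters _ [::
  (fun c => `[< vert c.1 c >]); (fun c => `[< vert c.1.+1 c >]);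
  (fun c => `[< horz c.2 c >]); (fun c => `[< horz c.2.+1 c >]);
  (fun c => `[< exists t, crit c t >])] T _) _.
  move=> c cT /=; rewrite orbF.
  have [//|/asboolPn nv1] := boolP `[< vert c.1 c >].
  have [//|/asboolPn nv2] := boolP `[< vert c.1.+1 c >].
  have [//|/asboolPn nh1] := boolP `[< horz c.2 c >].
  have [//|/asboolPn nh2] := boolP `[< horz c.2.+1 c >].
  apply/asboolP.
  have [p pc Pp] := zT c cT; have /andP[c1M c2M] := bT c cT.
  have c1M' := ltnW c1M; have c2M' := ltnW c2M.
  have vert0 i : (i <= M)%N -> ~ vert i c ->
      forall t, y c.2 <= t <= y c.2.+1 -> P.[x i, t] != 0.
    move=> iM nv t; rewrite !le_eqVlt => /andP[/predU1P[<- _|t1]]; first exact: corner.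
    move=> /predU1P[->|t2]; first exact: corner.
    by apply/negP => rt; apply: nv; exists t; rewrite ?t1.
  have horz0 j : (j <= M)%N -> ~ horz j c ->
      forall t, x c.1 <= t <= x c.1.+1 -> P.[t, y j] != 0.
    move=> jM nv t; rewrite !le_eqVlt => /andP[/predU1P[<- _|t1]]; first exact: corner.
    move=> /predU1P[->|t2]; first exact: corner.
    by apply/negP => rt; apply: nv; exists t; rewrite ?t1 // /root horner_map_eval.
  have pc1 : (p.1 %/ L)%N = c.1 by rewrite -pc.
  have pc2 : (p.2 %/ L)%N = c.2 by rewrite -pc.
  have := inx p.1; have := iny p.2; rewrite pc1 pc2.
  move=> /andP[yp1 yp2] /andP[xp1 xp2].
  have [||||||s [t [sx ty Pst dPst]]] := @CriticalPoints.exists_critical_point R P (x c.1) (x c.1.+1) (y c.2) (y c.2.+1)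
     p.1%:R p.2%:R _ _ Pp.
  - by rewrite !ltW.
  - by rewrite !ltW.
  - exact: horz0.
  - exact: horz0.
  - exact: vert0.
  - exact: vert0.
  exists t; split=> //; last by exists s.
    have := congr1 (fun Q : {poly {poly R}} => Q.[s, t]) eqr.
    by rewrite hornerD !hornerM !hornerC hornerD !hornerM Pst dPst !mulr0 addr0.
  by apply: vert0 => //; case/andP: ty => ? ?; rewrite !ltW.
rewrite /= addn0.
have boundv (k : nat -> nat) : (forall i, (i < M)%N -> (k i <= M)%N) ->
    (size [seq c <- T | `[< vert (k c.1) c >]] <= M * sizeY P)%N.
  move=> kM; apply: (@size_le_edge_zeros _ fst snd M _ (fun i => P.[(x (k i))%:P]) y) => //.
  - by rewrite filter_uniq.
  - by move=> [a b] [a' b'] /= -> ->.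
  - by move=> i iM; apply: vert_poly; exact: kM.
  by move=> c; rewrite mem_filter => /andP[/asboolP vc /bT /andP[]].
have boundh (k : nat -> nat) : (forall i, (i < M)%N -> (k i <= M)%N) ->
    (size [seq c <- T | `[< horz (k c.2) c >]] <= M * size P)%N.
  move=> kM; apply: (@size_le_edge_zeros _ snd fst M _
    (fun j => map_poly (horner_eval (y (k j))) P) x) => //.
  - by rewrite filter_uniq.
  - by move=> [a b] [a' b'] /= -> ->.
  - by move=> i iM; apply: horz_poly; exact: kM.
  by move=> c; rewrite mem_filter => /andP[/asboolP vc /bT /andP[]].
have boundc : (size [seq c <- T | `[< exists t, crit c t >]] <= size r * size P)%N.
  set T' := [seq c <- T | _].
  (* On [T'] the set is nonempty, so [h] picks a genuine critical ordinate rather than the default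
     [0]. *)
  pose h c := xget 0 [set t | crit c t]%classic.
  have hE c : c \in T' -> crit c (h c).
    by rewrite mem_filter => /andP[/asboolP/(@xgetPex _ 0 [set t | crit c t]%classic)].
  apply: leq_trans (@size_le_fibers _ _ h (undup (map h T')) T' (size P) _ _) _.
  - by move=> c cT; rewrite mem_undup map_f.
  - move=> t; rewrite mem_undup => /mapP[c0 c0T t0E].
    have [_ _ sl _] := hE _ c0T; move: sl; rewrite -t0E => sl.
    have sl0 : map_poly (horner_eval t) P != 0.
      by apply: contraNneq sl; rewrite -horner_map_eval => ->; rewrite horner0.
    rewrite -size_filter; apply: leq_trans (size_slice_leq P t); apply: ltnW.
    apply: (@size_lt_roots _ _ _ _ (fun c s => (x c.1 < s < x c.1.+1) /\ (y c.2 < t < y c.2.+1)) sl0).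
    + by rewrite !filter_uniq.
    + move=> c; rewrite mem_filter => /andP[/eqP hc /hE]; rewrite hc => -[_ yt _ [s Ps xs]].
      by exists s => //; rewrite /root horner_map_eval Ps.
    move=> [a b] [a' b'] _ _ s /= [/andP[s1 s2] /andP[t1 t2]] [/andP[s3 s4] /andP[t3 t4]].
    have -> : a = a'.
      case: (ltngtP a a') => // /homox le.
        by have := lt_trans (lt_le_trans s2 le) s3; rewrite ltxx.
      by have := lt_trans (lt_le_trans s4 le) s1; rewrite ltxx.
    have -> // : b = b'.
    case: (ltngtP b b') => // /homoy le.
      by have := lt_trans (lt_le_trans t2 le) t3; rewrite ltxx.
    by have := lt_trans (lt_le_trans t4 le) t1; rewrite ltxx.
  rewrite leq_mul2r; apply/orP; right; apply: ltnW.
  apply: (@size_lt_roots _ _ r _ (fun t t' => t = t') r0 (undup_uniq _)).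
    move=> t; rewrite mem_undup => /mapP[c /hE[rt _ _ _] ->]; exists (h c) => //.
    by apply/eqP.
  by move=> t t' _ _ z -> ->.
have leM i : (i < M)%N -> (i <= M)%N by exact: ltnW.
apply: leq_trans (leq_add (boundv id leM) (leq_add (boundv succn (fun _ => id))
  (leq_add (boundh id leM) (leq_add (boundh succn (fun _ => id)) boundc)))) _.
rewrite mulnCA mulnDr mul2n -addnn -!addnA leq_add2l.
by apply: eq_leq; exact: addnCA.
Qed.

End Cells.

(* Every point is translated to the representative of its cell; the translation
   vector is stored with both entries increased by [L] to stay in [nat]. *)
Lemma size_le_cells_translates (L B : nat) (S : seq (nat * nat)) :
  (0 < L)%N -> uniq S ->
  (forall k : nat * nat, k != (L, L) -> forall S', uniq S' -> {subset S' <= S} ->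
    {in S', forall p : nat * nat, exists2 q : nat * nat, q \in S &
       (q.1 + L = p.1 + k.1 /\ q.2 + L = p.2 + k.2)%N} -> (size S' <= B)%N) ->
  (size S <= size (undup [seq (p.1 %/ L, p.2 %/ L)%N | p <- S])
             + (2 * L) * (2 * L) * B)%N.
Proof.
move=> L0 uS hB.
pose cell (p : nat * nat) := (p.1 %/ L, p.2 %/ L)%N.
pose rep p := nth p S (find (fun q => cell q == cell p) S).
have hasp p : p \in S -> has (fun q => cell q == cell p) S.
  by move=> pS; apply/hasP; exists p.
have repS p : p \in S -> rep p \in S.
  by move=> pS; rewrite mem_nth // -has_find hasp.
have cell_rep p : p \in S -> cell (rep p) = cell p.
  by move=> pS; apply/eqP; apply: (nth_find p (hasp p pS)).
have rep_cell p p' : p \in S -> cell p = cell p' -> rep p = rep p'.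
  by move=> pS e; rewrite /rep e; apply: set_nth_default; rewrite -has_find -e hasp.
pose key p := ((rep p).1 + L - p.1, (rep p).2 + L - p.2)%N.
(* Numbers in the same block of length [L] differ by less than [L], so the subtraction shifted by
   [L] is not truncated. *)
have near (a b : nat) : (a %/ L = b %/ L ->
    [/\ a + L - b < 2 * L, a + L - b = L -> a = b & a + L = b + (a + L - b)])%N.
  move=> e; rewrite (divn_eq a L) (divn_eq b L) e.
  by have := ltn_pmod b L0; have := ltn_pmod a L0; split; lia.
have near1 p : p \in S -> [/\ (key p).1 < 2 * L, (key p).1 = L -> (rep p).1 = p.1
    & (rep p).1 + L = p.1 + (key p).1]%N.
  by move=> pS; apply: near; have [] := cell_rep p pS.
have near2 p : p \in S -> [/\ (key p).2 < 2 * L, (key p).2 = L -> (rep p).2 = p.2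
    & (rep p).2 + L = p.2 + (key p).2]%N.
  by move=> pS; apply: near; have [] := cell_rep p pS.
apply: leq_trans (@size_le_filters _ [:: (fun p => rep p == p); (fun p => rep p != p)] S _) _.
  by move=> p _ /=; case: (rep p == p).
rewrite /= addn0; apply: leq_add.
  rewrite -(size_map cell); apply: uniq_leq_size.
    rewrite map_inj_in_uniq ?filter_uniq // => p p'.
    rewrite !mem_filter => /andP[/eqP rp pS] /andP[/eqP rp' _] e.
    by rewrite -rp -rp'; apply: rep_cell.
  by move=> _ /mapP[p + ->]; rewrite mem_filter mem_undup => /andP[_ /(map_f cell)].
set S1 := [seq p <- S | _].
apply: leq_trans (@size_le_fibers _ _ key
  [seq (i, j) | i <- iota 0 (2 * L), j <- iota 0 (2 * L)] S1 B _ _) _.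
- move=> p; rewrite mem_filter => /andP[_ pS].
  have [k1 _ _] := near1 p pS; have [k2 _ _] := near2 p pS.
  by apply: allpairs_f; rewrite mem_iota.
- move=> k _; rewrite -size_filter.
  (* The key [(L, L)] encodes the zero vector, which occurs only for representatives, and these are
     not in [S1]. *)
  have [kL|kL] := eqVneq k (L, L).
    suff -> : [seq a <- S1 | key a == k] = [::] by [].
    rewrite -(filter_pred0 S1); apply: eq_in_filter => p.
    rewrite mem_filter => /andP[np pS] /=; apply: contraNF np; rewrite kL => /eqP pk.
    have [_ e1 _] := near1 p pS; have [_ e2 _] := near2 p pS.
    by apply/eqP; rewrite (surjective_pairing (rep p)) e1 ?e2 ?pk // -surjective_pairing.
  apply: (hB k kL).
  - by rewrite !filter_uniq.
  - by move=> p; rewrite !mem_filter => /andP[_ /andP[]].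
  move=> p; rewrite !mem_filter => /andP[/eqP <- /andP[_ pS]].
  have [_ _ q1] := near1 p pS; have [_ _ q2] := near2 p pS.
  by exists (rep p); first exact: repS.
by rewrite size_allpairs !size_iota.
Qed.

(** * Induction on the degree in x *)

Lemma sizeY_deriv (R : nzRingType) (P : {poly {poly R}}) : (sizeY P^`() <= sizeY P)%N.
Proof.
apply/bigmax_leqP => i _; rewrite coef_deriv -scaler_nat.
by apply: leq_trans (size_scale_leq _ _) _; apply: max_size_coefXY.
Qed.

(** The induction on [m] is for all [e] at once, because elimination lowers the degree in [x] at the
    cost of raising the degree in [y]. *)
Lemma few_zeros_bound (R : realType) (m e D : nat) :
  exists C, forall P : {poly {poly R}}, P != 0 -> (size P <= m.+1)%N ->
    (sizeY P <= e)%N -> few_zeros P D C.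
Proof.
elim: m e => [|m IHm] e.
  exists (e * D)%N => P P0 szP eP L S L0 uS bS lS zS.
  have [q q0 Pq] : exists2 q, q != 0 & P = q%:P.
    by apply/size_poly1P/eqP/anti_leq; rewrite szP size_poly_gt0.
  have szq : (size q <= e)%N by rewrite -sizeYC -Pq.
  apply: leq_trans (size_le_ordinates q0 lS _) _.
    by move=> p /zS; rewrite Pq hornerC.
  by rewrite (leq_trans (leq_mul szq (leqnn D))) // leq_pmulr // expn_gt0 L0.
(* A translate of [P] has [sizeY] at most [e + 1], whence [e1] for its pseudo-remainder with [P]. *)
pose e1 := (e + 1 + 1 + (e + 1))%N.
have [N hN] := @bounded_elimination R m.+2 e1.
have [C0 hC0] := IHm (maxn N e1).
(* [C1] collects edge zeros, critical points, and [(2 * L) ^ 2] translation vectors with [N * D]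
   points each. [C] adds two induction bounds for a vanishing eliminant, and the periodic case. *)
pose C1 := (2 * (e + m.+2) + N * m.+2 + 4 * (N * D))%N.
pose C := (C0 + C0 + (e + m.+2) * D + C1)%N; exists C => P P0 szP eP.
have ee1 : (e <= e1)%N by rewrite /e1; lia.
have [szP'|szP'] := leqP (size P) m.+1.
  apply: (@few_zeros_mono _ _ _ C0); first by rewrite /C; lia.
  by apply: hC0 => //; rewrite leq_max (leq_trans eP ee1) orbT.
have szPm : size P = m.+2 by apply/anti_leq; rewrite szP szP'.
have szP1 : (1 < size P <= m.+2)%N by rewrite szP szPm.
have alternative (Q : {poly {poly R}}) : Q != 0 -> (size Q < size P)%N -> (sizeY Q <= e1)%N ->
    few_zeros P D C \/ exists U W r,
      [/\ U * P + W * Q = r%:P, r != 0 & (size r <= N)%N].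
  move=> Q0 szQ eQ.
  have [|||U [W [r [eqr W0 szW eW szr]]]] := hN P Q Q0 szP1.
  - by rewrite (leq_trans (ltnW szQ)).
  - exact: leq_trans eP ee1.
  - exact: eQ.
  have [r0|r0] := eqVneq r 0; last by right; exists U, W, r.
  left; apply: (@few_zeros_mono _ _ _ (C0 + C0)); first by rewrite /C; lia.
  have szPS (V : {poly {poly R}}) : (size V < size P)%N -> (size V <= m.+1)%N.
    by rewrite szPm ltnS.
  apply: (@few_zeros_union _ _ W Q).
  - move=> x y Pxy; have := congr1 (fun V : {poly {poly R}} => V.[x, y]) eqr.
    by rewrite r0 hornerD !hornerM !hornerC hornerD !hornerM Pxy mulr0 add0r ?horner0.
  - by apply: hC0; [| exact: szPS | rewrite leq_max eW].
  - by apply: hC0; [| exact: szPS | rewrite leq_max eQ orbT].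
have dP0 : P^`() != 0.
  apply: contraTneq P0 => dP0; rewrite negbK -lead_coef_eq0 lead_coefE szPm.
  have /eqP := congr1 (fun V : {poly {poly R}} => V`_m) dP0.
  rewrite coef_deriv coef0 -mulr_natl mulf_eq0 -polyC_natr polyC_eq0.
  by rewrite pnatr_eq0.
have [||//|[U [W [r [eqr r0 szr]]]]] := alternative P^`() dP0.
- by rewrite lt_size_deriv.
- exact: leq_trans (sizeY_deriv P) (leq_trans eP ee1).
(* From here on the bound is assumed to fail, so that a vanishing eliminant and the periodic case,
   which each bound all zeros of [P] at once, become contradictions. *)
have [//|nfew] := pselect (few_zeros P D C).
(* A nonzero eliminant [r'] confines the common zeros of [P] and its translate to at most [N]
   horizontal lines. *)
have translates (a b : R) S : (a != 0) || (b != 0) -> uniq S -> line_bounded R D S ->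
    {in S, forall p, P.[p.1%:R, p.2%:R] = 0 /\ P.[p.1%:R + a, p.2%:R + b] = 0} ->
    (size S <= N * D)%N.
  move=> ab uS lS zS; set Q := pseudo_rem P (shift P a b).
  have [Q0|Q0] := eqVneq Q 0.
    case: nfew; apply: (@few_zeros_mono R P D) (@few_zeros_of_periodic R P D a b P0 ab Q0).
    have : ((sizeY P + size P) * D <= (e + m.+2) * D)%N.
      by rewrite leq_mul2r leq_add ?orbT.
    by rewrite /C; lia.
  have [||//|[U' [W' [r' [eqr' r'0 szr']]]]] := alternative Q Q0.
  - by apply: size_pseudo_rem; rewrite // -?size_poly_eq0 size_shift // size_poly_eq0.
  - apply: sizeY_pseudo_rem; first by apply: leq_trans eP _; rewrite leq_addr.
    by apply: leq_trans (sizeY_shift _ _ _) _; rewrite leq_add2r.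
  apply: leq_trans (size_le_ordinates r'0 lS _) _; last by rewrite leq_mul2r szr' orbT.
  move=> p /zS[z1 z2]; have := congr1 (fun V : {poly {poly R}} => V.[p.1%:R, p.2%:R]) eqr'.
  rewrite hornerD !hornerM !hornerC hornerD !hornerM z1 mulr0 add0r => <-.
  rewrite /Q /pseudo_rem hornerD hornerN !hornerM hornerD hornerN !hornerM.
  by rewrite horner_shift z1 z2 !mulr0 subr0 mulr0.
move=> L S L0 uS bS lS zS.
apply: (@leq_trans (C1 * L ^ 2)%N); last by rewrite leq_mul2r /C leq_addl orbT.
apply: leq_trans (@size_le_cells_translates L (N * D) S L0 uS _) _.
  move=> [k1 k2] kL S' uS' subS hS'.
  apply: (@translates (k1%:R - L%:R) (k2%:R - L%:R)) => //.
  - by rewrite !subr_eq0 !eqr_nat -negb_and; exact: kL.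
  - move=> a b c ab; apply: leq_trans (lS a b c ab).
    by rewrite -!size_filter; apply: uniq_leq_size; rewrite ?filter_uniq // => p;
      rewrite !mem_filter => /andP[-> /subS].
  move=> p pS'; have [q qS [/= q1 q2]] := hS' p pS'; split; first by apply: zS; exact: subS.
  have qE (i j k : nat) : (j + L = i + k)%N -> i%:R + (k%:R - L%:R) = j%:R :> R.
    by move=> h; rewrite addrA -natrD -h natrD addrK.
  by rewrite (qE _ _ _ q1) (qE _ _ _ q2); exact: zS.
set T := undup _.
(* A box of side [L ^ 3] has [L ^ 2] cells of side [L] in each direction. *)
have szT : (size T <= L ^ 2 * (2 * (e + m.+2)) + N * m.+2)%N.
  apply: leq_trans (@size_cells_leq _ P U W r L (L ^ 2) T P0 eqr r0 L0 (undup_uniq _) _ _) _.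
  - move=> c; rewrite mem_undup => /mapP[p /bS /andP[p1 p2] ->] /=.
    by rewrite !ltn_divLR // -expnSr p1 p2.
  - by move=> c; rewrite mem_undup => /mapP[p pS ->]; exists p => //; exact: zS.
  by rewrite szPm; apply: leq_add; rewrite ?leq_mul // leq_add2r.
apply: leq_trans (leq_add szT (leqnn _)) _.
have L2 : (0 < L ^ 2)%N by rewrite expn_gt0 L0.
rewrite /C1; move: (N * m.+2)%N (e + m.+2)%N (N * D)%N L2 => x y z.
have -> : (2 * L * (2 * L) = 4 * L ^ 2)%N by rewrite -mulnn; lia.
by nia.
Qed.

(** * Linear factors *)

From mathcomp Require Import finmap mpoly.
Import Order.TTheory GRing.Theory Num.Theory.

Lemma size_affine (B : comNzRingType) (u v : B) : (size (u%:P + v%:P * 'X)%R <= 2)%N.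
Proof.
apply: leq_trans (size_polyD _ _) _; rewrite geq_max.
rewrite (leq_trans (size_polyC_leq1 _)) //= mul_polyC.
by rewrite (leq_trans (size_scale_leq _ _)) // size_polyX.
Qed.

Lemma sum_sqr_neq0 (R : realDomainType) (a b : R) :
  (a != 0) || (b != 0) -> a ^+ 2 + b ^+ 2 != 0.
Proof. by rewrite paddr_eq0 ?sqr_ge0 // !sqrf_eq0 negb_and. Qed.

Section Substitution.
Variables (R : realType).
Implicit Types (f : {mpoly R[2]}).

(** With the target ring and the coefficient map left arbitrary, evaluation, restriction to a line
    and affine rescaling are instances of one formula. *)
Definition subst2 (A : comNzRingType) (g : R -> A) (X Y : A) f : A :=
  \sum_(m <- msupp f) g f@_m * (X ^+ m ord0 * Y ^+ m ord_max).

Lemma eval2E f x y : eval2 f x y = subst2 idfun x y f.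
Proof.
rewrite /eval2 /meval /mmap /subst2; apply: eq_bigr => m _.
rewrite /mmap1 big_ord_recl big_ord_recl big_ord0 mulr1 !(tnth_nth 0) /=.
by congr (_ * (_ * _ ^+ m _)); apply: val_inj.
Qed.

Lemma subst2_id f : subst2 (@mpolyC 2 R) 'X_ord0 'X_ord_max f = f.
Proof.
rewrite [RHS]mpolyE; apply: eq_bigr => m _; rewrite mul_mpolyC; congr (_ *: _).
rewrite [RHS]mpolyXE_id big_ord_recl big_ord_recl big_ord0 mulr1.
by rewrite (_ : lift ord0 ord0 = ord_max :> 'I_2); last exact: val_inj.
Qed.

Lemma rmorph_subst2 (A B : comNzRingType) (phi : {rmorphism A -> B}) g X Y f :
  phi (subst2 g X Y f) = subst2 (phi \o g) (phi X) (phi Y) f.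
Proof.
by rewrite rmorph_sum; apply: eq_bigr => m _; rewrite !rmorphM !rmorphXn.
Qed.

Lemma size_subst2 (B : comNzRingType) (g : R -> {poly B}) (X Y : {poly B}) f :
  (forall c, (size (g c) <= 1)%N) -> (size X <= 2)%N -> (size Y <= 2)%N ->
  (size (subst2 g X Y f) <= msize f)%N.
Proof.
move=> hg hX hY.
have hpow (Z : {poly B}) n : (size Z <= 2)%N -> (size (Z ^+ n) <= n.+1)%N.
  move=> hZ; apply: leq_trans (size_poly_exp_leq _ _) _.
  by rewrite ltnS -[X in (_ <= X)%N]mul1n leq_mul2r -subn1 leq_subLR hZ orbT.
apply: leq_trans (size_sum _ _ _) _; rewrite big_seq_cond.
apply/bigmax_leqP_seq => m _; rewrite andbT => /msize_mdeg_lt; apply: leq_trans.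
have mulle (p q : {poly B}) i j : (size p <= i.+1)%N -> (size q <= j.+1)%N ->
    (size (p * q)%R <= (i + j).+1)%N.
  move=> hp hq; apply: leq_trans (size_polyMleq _ _) _.
  by rewrite -subn1 leq_subLR add1n -addnS -addSn leq_add.
have -> : (mdeg m).+1 = (0 + (m ord0 + m ord_max)).+1.
  rewrite mdegE big_ord_recl big_ord_recl big_ord0 addn0 add0n.
  by rewrite (_ : lift ord0 ord0 = ord_max :> 'I_2) //; exact: val_inj.
by apply: (mulle); rewrite ?hg //; apply: (mulle); exact: hpow.
Qed.

(** Congruence modulo the ideal generated by [l] is compatible with sums and products. *)
Lemma subst2_congr (A : comNzRingType) (g : R -> A) (l X Y X' Y' : A) f :
  (exists u, X - X' = l * u) -> (exists u, Y - Y' = l * u) ->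
  exists u, subst2 g X Y f - subst2 g X' Y' f = l * u.
Proof.
move=> XX' YY'.
have mulc (x y x' y' : A) : (exists u, x - x' = l * u) -> (exists u, y - y' = l * u) ->
    exists u, x * y - x' * y' = l * u.
  move=> [u xx'] [v yy']; exists (u * y + x' * v).
  have -> : x * y - x' * y' = (x - x') * y + x' * (y - y') by ring.
  by rewrite xx' yy'; ring.
have expc (x x' : A) n : (exists u, x - x' = l * u) -> exists u, x ^+ n - x' ^+ n = l * u.
  move=> xx'; elim: n => [|n IH]; first by exists 0; rewrite !expr0 subrr mulr0.
  by rewrite !exprS; exact: mulc.
apply: (big_ind2 (fun a b => exists u, a - b = l * u)).
- by exists 0; rewrite subrr mulr0.
- by move=> a a' b b' [u e] [v e']; exists (u + v); rewrite mulrDr -e -e'; ring.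
move=> m _; apply: (mulc); first by exists 0; rewrite subrr mulr0.
by apply: (mulc); exact: expc.
Qed.

(* With [l = a X + b Y - c] and [w = a Y - b X], the polynomial [f] is congruent
   modulo [l] to its restriction to the line [l = 0], written as a polynomial in [w]. *)
Lemma linear_factor_of_line f (a b c : R) : (a != 0) || (b != 0) ->
  (forall t, eval2 f ((a * c - b * t) / (a ^+ 2 + b ^+ 2))
                     ((b * c + a * t) / (a ^+ 2 + b ^+ 2)) = 0) ->
  ~ no_linear_factor f.
Proof.
move=> ab0 hf; apply.
set n := a ^+ 2 + b ^+ 2 in hf.
have n0 : n != 0 by exact: sum_sqr_neq0.
pose l : {mpoly R[2]} := a *: 'X_ord0 + b *: 'X_ord_max - c%:MP.
pose w : {mpoly R[2]} := a *: 'X_ord_max - b *: 'X_ord0.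
(* [X] and [Y] parametrize the line from the foot of the perpendicular through the origin, in
   direction [(- b, a)]. *)
pose X : {poly R} := (a * c / n)%:P - (b / n) *: 'X.
pose Y : {poly R} := (b * c / n)%:P + (a / n) *: 'X.
have F0 : subst2 polyC X Y f = 0.
  apply: (@eq0_of_nat_roots _ _ 0) => k _; rewrite -[RHS](hf k%:R) eval2E.
  rewrite -[LHS]/(horner_eval k%:R _) rmorph_subst2; apply: eq_bigr => m _ /=.
  rewrite /horner_eval hornerC.
  have -> : X.[k%:R] = (a * c - b * k%:R) / n by rewrite !hornerE; field.
  by have -> : Y.[k%:R] = (b * c + a * k%:R) / n by rewrite !hornerE; field.
(* [phi] puts the linear form [w] in place of the parameter, turning [F0] into an identity in
   [{mpoly R[2]}]. *)
pose phi : {poly R} -> {mpoly R[2]} := horner_eval w \o map_poly (@mpolyC 2 R).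
have := congr1 phi F0.
rewrite /phi rmorph0 rmorph_subst2 /=.
have phiX : (map_poly (@mpolyC 2 R) X).[w] = (a * c / n)%:MP - (b / n) *: w.
  by rewrite /X rmorphB /= map_polyC linearZ /= map_polyX !hornerE mul_mpolyC.
have phiY : (map_poly (@mpolyC 2 R) Y).[w] = (b * c / n)%:MP + (a / n) *: w.
  by rewrite /Y rmorphD /= map_polyC linearZ /= map_polyX !hornerE mul_mpolyC.
rewrite /horner_eval phiX phiY.
rewrite (_ : subst2 _ _ _ f = subst2 (@mpolyC 2 R) ((a * c / n)%:MP - (b / n) *: w)
    ((b * c / n)%:MP + (a / n) *: w) f); last first.
  by apply: eq_bigr => m _; rewrite /= map_polyC hornerC.
move=> G0.
have nI : (a%:MP ^+ 2 + b%:MP ^+ 2) * n^-1%:MP = 1 :> {mpoly R[2]}.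
  by rewrite -!rmorphXn -rmorphD -rmorphM divff.
have [||u fE] := @subst2_congr _ (@mpolyC 2 R) l 'X_ord0 'X_ord_max
  ((a * c / n)%:MP - (b / n) *: w) ((b * c / n)%:MP + (a / n) *: w) f.
(* The coordinate minus its expression in [w] is [a / n] times [l], because
   [a ^+ 2 + b ^+ 2 = n]. *)
- exists (a / n)%:MP; apply/eqP; rewrite -subr_eq0.
  rewrite (_ : _ - _ = 'X_ord0 * (1 - (a%:MP ^+ 2 + b%:MP ^+ 2) * n^-1%:MP)).
    by rewrite nI subrr mulr0.
  by rewrite /l /w -!mul_mpolyC !mpolyCM; ring.
- exists (b / n)%:MP; apply/eqP; rewrite -subr_eq0.
  rewrite (_ : _ - _ = 'X_ord_max * (1 - (a%:MP ^+ 2 + b%:MP ^+ 2) * n^-1%:MP)).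
    by rewrite nI subrr mulr0.
  by rewrite /l /w -!mul_mpolyC !mpolyCM; ring.
exists l, u; split; last by rewrite -fE G0 subr0 subst2_id.
have lcoef (i : 'I_2) : l@_U_(i) = if i == ord0 then a else b.
  rewrite /l mcoeffB mcoeffD !mcoeffZ !mcoeffX mcoeffC -mdeg_eq0 mdeg1 mulr0 subr0.
  rewrite !eq_mnm1; case: i => -[|[|//]] ?; rewrite -!val_eqE /=.
    by rewrite mulr1 mulr0 addr0.
  by rewrite mulr1 mulr0 add0r.
apply/eqP; rewrite eqn_leq; apply/andP; split.
  apply: leq_trans (msizeD_le _ _) _; rewrite geq_max msizeN msizeC (leq_trans (leq_b1 _)) // andbT.
  apply: leq_trans (msizeD_le _ _) _; rewrite geq_max.
  by rewrite !(leq_trans (msizeZ_le _ _)) // msizeX mdeg1.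
have [i li] : exists i : 'I_2, l@_U_(i) != 0.
  by case/orP: ab0 => h; [exists ord0 | exists ord_max]; rewrite lcoef.
by have := @msize_mdeg_lt _ _ l U_(i)%MM; rewrite mdeg1 mcoeff_msupp; apply.
Qed.

(** The restriction of [f] to the line has degree at most [d] and is nonzero by
    [linear_factor_of_line]; a point of the line is recovered from its parameter [a * y - b * x]. *)
Lemma size_le_line_zeros f d (a b c : R) (ps : seq (R * R)) :
  has_degree f d -> no_linear_factor f -> (a != 0) || (b != 0) -> uniq ps ->
  {in ps, forall p, a * p.1 + b * p.2 = c /\ eval2 f p.1 p.2 = 0} -> (size ps <= d)%N.
Proof.
move=> degf nlf ab0 ups hps.
set n := a ^+ 2 + b ^+ 2.
have n0 : n != 0 by exact: sum_sqr_neq0.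
pose X : {poly R} := (a * c / n)%:P + (- (b / n))%:P * 'X.
pose Y : {poly R} := (b * c / n)%:P + (a / n)%:P * 'X.
pose F := subst2 polyC X Y f.
have FE t : F.[t] = eval2 f ((a * c - b * t) / n) ((b * c + a * t) / n).
  rewrite eval2E -[LHS]/(horner_eval t _) rmorph_subst2; apply: eq_bigr => m _ /=.
  rewrite /horner_eval hornerC.
  have -> : X.[t] = (a * c - b * t) / n by rewrite !hornerE; field.
  by have -> : Y.[t] = (b * c + a * t) / n by rewrite !hornerE; field.
have szF : (size F <= d.+1)%N.
  by rewrite -degf; apply: size_subst2; [exact: size_polyC_leq1 | exact: size_affine..].
have F0 : F != 0.
  apply/negP => /eqP F0; apply: (linear_factor_of_line (c := c) ab0) nlf => t.
  by rewrite -[LHS]FE F0 horner0.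
rewrite -ltnS; apply: leq_trans szF.
apply: (@size_lt_roots _ _ F ps (fun p t => p = ((a * c - b * t) / n, (b * c + a * t) / n)) F0 ups).
  move=> [x y] /hps[/= lxy f0]; exists (a * y - b * x).
    rewrite /root FE -lxy; apply/eqP; rewrite -[RHS]f0; congr (eval2 f _ _); rewrite /n; field; exact: n0.
  by rewrite -lxy; congr (_, _); rewrite /n; field; exact: n0.
by move=> p p' _ _ t -> ->.
Qed.

End Substitution.

(** * From the integer box to an arbitrary grid *)

Lemma exists_cube_approx (k : nat) : (0 < k)%N ->
  exists2 L, (0 < L)%N & (k <= L ^ 3 <= 8 * k)%N.
Proof.
case: k => // k _; elim: k => [|k [L L0 /andP[h1 h2]]]; first by exists 1%N.
(* [L] is kept until [k] passes [L ^ 3]; at that moment [L.+1 ^ 3 <= (2 * L) ^ 3] gives the factor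
   [8]. *)
have [h|h] := leqP k.+2 (L ^ 3); first by exists L => //; rewrite h; lia.
have kL : (k.+1 = L ^ 3)%N by lia.
exists L.+1 => //; rewrite kL; apply/andP; split.
  by rewrite ltn_exp2r.
apply: (@leq_trans ((2 * L) ^ 3)); first by rewrite leq_exp2r //; lia.
by rewrite expnMn leq_mul.
Qed.

Lemma powR_23_cube (R : realType) (x : R) : 0 <= x -> (x ^+ 3) `^ (2%:R / 3%:R) = x ^+ 2.
Proof.
move=> x0; rewrite -powR_mulrn // -powRrM mulrCA divff ?mulr1 ?powR_mulrn //.
by rewrite pnatr_eq0.
Qed.

Lemma sqr_le_powR_23 (R : realType) (k L : nat) : (L ^ 3 <= 8 * k)%N ->
  (L ^ 2)%:R <= 4 * k%:R `^ (2%:R / 3%:R) :> R.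
Proof.
move=> le; have -> : 4 = (2 ^+ 3) `^ (2%:R / 3%:R) :> R.
  by rewrite powR_23_cube // -natrX.
rewrite natrX -(@powR_23_cube _ L%:R) // -powRM ?exprn_ge0 //.
apply: ge0_ler_powR; rewrite ?nnegrE ?divr_ge0 ?exprn_ge0 ?mulr_ge0 //.
by rewrite -!natrX -natrM ler_nat.
Qed.

Section Scaling.
Variables (R : realType).
Implicit Types (f : {mpoly R[2]}).

(** This is [f] in the coordinates that turn the grid into an integer box; the outer variable is the
    index in the first progression. *)
Definition rescaled f (a1 d1 a2 d2 : R) : {poly {poly R}} :=
  subst2 (polyC \o polyC) (a1%:P%:P + d1%:P%:P * 'X) (a2%:P + d2%:P * 'X)%:P f.

Lemma rescaledE f a1 d1 a2 d2 x y :
  (rescaled f a1 d1 a2 d2).[x, y] = eval2 f (a1 + x * d1) (a2 + y * d2).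
Proof.
rewrite eval2E -[LHS]/(horner_eval y (horner_eval x%:P _)) !rmorph_subst2.
apply: eq_bigr => m _ /=; rewrite /horner_eval !hornerE.
by rewrite [x * _]mulrC [y * _]mulrC.
Qed.

Lemma size_rescaled f a1 d1 a2 d2 : (size (rescaled f a1 d1 a2 d2) <= msize f)%N.
Proof.
apply: size_subst2; last by rewrite (leq_trans (size_polyC_leq1 _)).
  by move=> c; exact: size_polyC_leq1.
exact: size_affine.
Qed.

(** Swapping the variables gives a substitution of the same shape, to which [size_subst2] applies
    again. *)
Lemma sizeY_rescaled f a1 d1 a2 d2 : (sizeY (rescaled f a1 d1 a2 d2) <= msize f)%N.
Proof.
have swapC (c : R) : swapXY c%:P%:P = c%:P%:P by rewrite swapXY_polyC map_polyC.
have swapX : swapXY (a1%:P%:P + d1%:P%:P * 'X) = (a1%:P + d1%:P * 'X)%:P.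
  by rewrite rmorphD rmorphM /= swapXY_X !swapC -polyCM -polyCD.
have swapY : swapXY (a2%:P + d2%:P * 'X)%:P = a2%:P%:P + d2%:P%:P * 'X.
  by rewrite swapXY_polyC rmorphD rmorphM /= !map_polyC map_polyX.
have -> : sizeY (rescaled f a1 d1 a2 d2) = size (subst2 (polyC \o polyC)
    (a1%:P + d1%:P * 'X)%:P (a2%:P%:P + d2%:P%:P * 'X) f).
  rewrite sizeYE /rescaled /subst2 rmorph_sum; congr (size (polyseq _)).
  apply: eq_bigr => m _; rewrite rmorphM rmorphM !rmorphXn /=.
  by rewrite swapC swapX swapY.
apply: size_subst2; [| by rewrite (leq_trans (size_polyC_leq1 _)) | exact: size_affine].
by move=> c; exact: size_polyC_leq1.
Qed.

End Scaling.

Theorem theorem7 (R : realType) (d : nat) (hd : (2 <= d)%N) :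
  exists C : R,
    forall f : {mpoly R[2]}, has_degree f d -> no_linear_factor f ->
    forall (k : nat) (G : {fset R * R}), (0 < k)%N -> is_grid k G ->
      (#|` [fset p in G | p \in curve f]%fset |%:R : R)
        <= C * (k%:R `^ (2%:R / 3%:R)).
Proof.
(* [msize f = d.+1] bounds both sizes of the rescaled polynomial, and a line carries at most [d]
   zeros. *)
have [C0 hC0] := @few_zeros_bound R d d.+1 d.
exists (4 * C0%:R + d%:R) => f degf nlf k G k0 [a1 [d1 [a2 [d2 ->]]]].
set Z := [fset p in _ | _]%fset.
have memZ p : p \in Z -> exists ij : nat * nat,
    [/\ (ij.1 < k)%N, (ij.2 < k)%N, p = (a1 + ij.1%:R * d1, a2 + ij.2%:R * d2)
      & eval2 f p.1 p.2 = 0].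
  rewrite !inE /= => /andP[/andP[/imfsetP[i /= + p1] /imfsetP[j /= + p2]]].
  rewrite !mem_iota !add0n => ik jk /set_mem fp; exists (i, j); split=> //.
  by rewrite -p1 -p2 -surjective_pairing.
have zle1 : 1 <= k%:R `^ (2%:R / 3%:R) :> R.
  have e1 : 1 `^ (2%:R / 3%:R) = 1 :> R by rewrite powR1.
  rewrite -[leLHS]e1.
  apply: ge0_ler_powR.
  - by rewrite divr_ge0.
  - by rewrite nnegrE.
  - by rewrite nnegrE.
  - by rewrite ler1n.
(* A vanishing common difference puts the grid on a line with at most [d] zeros; by [zle1] the
   summand [d%:R] of the constant covers this case. *)
have degenerate (a b c : R) : (a != 0) || (b != 0) ->
    {in Z, forall p, a * p.1 + b * p.2 = c} ->
    #|` Z|%:R <= (4 * C0%:R + d%:R) * k%:R `^ (2%:R / 3%:R) :> R.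
  move=> ab0 hl; have le : (size (enum_fset Z) <= d)%N.
    apply: (@size_le_line_zeros R f d a b c) => // [|p pZ]; first exact: fset_uniq.
    by split; [exact: hl | have [ij []] := memZ p pZ].
  have : #|` Z|%:R <= d%:R :> R by rewrite ler_nat.
  have : 0 <= C0%:R :> R by [].
  have : 0 <= d%:R :> R by [].
  by nra.
have [d10|d10] := eqVneq d1 0.
  apply: (degenerate 1 0 a1); first by rewrite oner_eq0.
  by move=> p /memZ[ij [_ _ -> _]] /=; rewrite d10; ring.
have [d20|d20] := eqVneq d2 0.
  apply: (degenerate 0 1 a2); first by rewrite oner_eq0 orbT.
  by move=> p /memZ[ij [_ _ -> _]] /=; rewrite d20; ring.
pose P := rescaled f a1 d1 a2 d2.
pose pt (ij : nat * nat) : R * R := (a1 + ij.1%:R * d1, a2 + ij.2%:R * d2).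
have pt_inj : injective pt.
  move=> [i j] [i' j'] [/addrI/(mulIf d10)/eqP + /addrI/(mulIf d20)/eqP].
  by rewrite !eqr_nat => /eqP -> /eqP ->.
(* The affine map [pt] carries lines to lines, so the bound for [f] passes to the integer
   coordinates. *)
have line_bound (T : seq (nat * nat)) a b c : (a != 0) || (b != 0) -> uniq T ->
    {in T, forall ij, (a * ij.1%:R + b * ij.2%:R = c :> R) /\ P.[ij.1%:R, ij.2%:R] = 0} ->
    (size T <= d)%N.
  move=> ab0 uT hT; rewrite -(size_map pt).
  apply: (@size_le_line_zeros R f d (a / d1) (b / d2) (c + a * a1 / d1 + b * a2 / d2)) => //.
  - by rewrite !mulf_eq0 !invr_eq0 (negbTE d10) (negbTE d20) !orbF.
  - by rewrite map_inj_uniq.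
  move=> _ /mapP[ij /hT[<- Pij] ->]; rewrite /pt /=; split; last by rewrite -rescaledE.
  by field; rewrite d10 d20.
(* Otherwise the [d.+1] collinear points [(i, 0)] would all be zeros, against [line_bound]. *)
have P0 : P != 0.
  apply/negP => /eqP P0; suff : (size [seq (i, 0%N) | i <- iota 0 d.+1] <= d)%N.
    by rewrite size_map size_iota ltnn.
  apply: (line_bound _ 0 1 0); first by rewrite oner_eq0 orbT.
    by rewrite map_inj_uniq ?iota_uniq // => i j [].
  by move=> _ /mapP[i _ ->]; rewrite P0 !horner0 /=; split=> //; ring.
have [L L0 /andP[kL Lk]] := exists_cube_approx k0.
pose S := [seq ij <- [seq (i, j) | i <- iota 0 k, j <- iota 0 k] | P.[ij.1%:R, ij.2%:R] == 0].
have uS : uniq S.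
  by rewrite filter_uniq // allpairs_uniq ?iota_uniq // => -[i j] [i' j'].
have szZ : (#|` Z| <= size S)%N.
  rewrite -(size_map pt); apply: uniq_leq_size; first exact: fset_uniq.
  move=> p /memZ[[i j] [/= ik jk -> fp]]; apply/mapP; exists (i, j) => //.
  by rewrite mem_filter rescaledE /= fp eqxx allpairs_f // mem_iota.
have szS : (size S <= C0 * L ^ 2)%N.
  apply: (hC0 P P0 _ _ L S L0 uS).
  - by rewrite (leq_trans (size_rescaled _ _ _ _ _)) // degf.
  - by rewrite (leq_trans (sizeY_rescaled _ _ _ _ _)) // degf.
  - move=> p; rewrite mem_filter => /andP[_ /allpairsP[[i j] [/= + + ->]]].
    by rewrite !mem_iota !add0n /= => ik jk; rewrite !(leq_trans _ kL).
  - move=> a b c ab0; rewrite -size_filter; apply: (line_bound _ a b c) => //.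
      by rewrite filter_uniq.
    by move=> p; rewrite mem_filter => /andP[/eqP -> ]; rewrite mem_filter => /andP[/eqP -> _].
  - by move=> p; rewrite mem_filter => /andP[/eqP].
have : #|` Z|%:R <= C0%:R * (L ^ 2)%:R :> R.
  by rewrite -natrM ler_nat (leq_trans szZ).
have := @sqr_le_powR_23 R k L Lk.
have : 0 <= C0%:R :> R by [].
have : 0 <= d%:R :> R by [].
by nra.
Qed.
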